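(* Let $\mathbb{X}$ be a finite set, $p_X$ a probability mass function on $\mathbb{X}$ with $p_X(x)>0$ for all $x$, $\mathcal{H}_A$ a finite-dimensional Hilbert space, $\{\rho_A^x\}_{x\in\mathbb{X}}$ density operators on $\mathcal{H}_A$, and $\rho_{XA}=\sum_{x\in\mathbb{X}}p_X(x)\ket{x}\bra{x}\otimes\rho_A^x$ with $\rho_X=\sum_x p_X(x)\ket{x}\bra{x}$, where $\{\ket{x}\}$ is an orthonormal basis of a Hilbert space of dimension $|\mathbb{X}|$. Then for every order $\alpha\in(0,\infty]$, \[ \widetilde{I}_\alpha(X;A)_{\rho_{XA}}\leq\widetilde{I}_\infty(X;A)_{\rho_{XA}}\leq\mathcal{B}(X\rightarrow A)_{\rho_A}\leq\mathcal{R}(X\rightarrow A)_{\rho_A}. \]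
   Context: All logarithms are base 2. For a density operator $\rho$ and positive semi-definite $\sigma$ with $\operatorname{supp}\rho\subseteq\operatorname{supp}\sigma$ and $\alpha\in(0,1)\cup(1,\infty)$, the sandwiched quantum Rényi relative entropy is $\widetilde{D}_\alpha(\rho\|\sigma)=\frac{1}{\alpha-1}\log\operatorname{tr}\big((\sigma^{\frac{1-\alpha}{2\alpha}}\rho\sigma^{\frac{1-\alpha}{2\alpha}})^\alpha\big)$ (set to $+\infty$ when the support condition fails and $\alpha\geq1$; for $\alpha<1$ the formula is used regardless); $\widetilde{D}_1(\rho\|\sigma)=\operatorname{tr}(\rho(\log\rho-\log\sigma))$ and $\widetilde{D}_\infty(\rho\|\sigma)=\log\inf\{\mu\in\mathbb{R}:\rho\leq\mu\sigma\}$ are the limits. The sandwiched quantum $\alpha$-mutual information is $\widetilde{I}_\alpha(X;A)_{\rho_{XA}}=\inf_{\sigma}\widetilde{D}_\alpha(\rho_{XA}\|\rho_X\otimes\sigma)$, infimum over density operators $\sigma$ on $\mathcal{H}_A$. $\Delta(\mathbb{X})$ is the set of probability mass functions on $\mathbb{X}$; $\mathcal{B}(X\rightarrow A)_{\rho_A}=\min_{\pi\in\Delta(\mathbb{X})}\max_{x}\widetilde{D}_\infty\big(\rho_A^x\|\sum_{x'}\pi(x')\rho_A^{x'}\big)$ and $\mathcal{R}(X\rightarrow A)_{\rho_A}=\max_{x,x'}\widetilde{D}_\infty(\rho_A^x\|\rho_A^{x'})$. *)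

(* Defs.v *)
From HB Require Import structures.
From mathcomp Require Import all_boot all_order all_algebra.
From mathcomp Require Import all_classical all_reals all_analysis.
From mathcomp Require Import complex mxtens.

Set Implicit Arguments.
Unset Strict Implicit.
Unset Printing Implicit Defensive.

Import Order.TTheory GRing.Theory Num.Theory.
Local Open Scope ring_scope.
Local Open Scope classical_set_scope.

Section QuantumRenyi.
Variable R : realType.
Local Notation C := (R[i]).

Definition RtoC (r : R) : C := Complex r 0.

Definition ReC (z : C) : R := let: Complex r _ := z in r.

Definition adjmx m n (A : 'M[C]_(m, n)) : 'M[C]_(n, m) := map_mx Num.conj A^T.

Definition psdmx n (A : 'M[C]_n) : Prop :=
  A = adjmx A /\ forall v : 'cV[C]_n, 0 <= (adjmx v *m A *m v) 0 0.

Definition density n (A : 'M[C]_n) : Prop := psdmx A /\ \tr A = 1.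

Definition loewner n (A B : 'M[C]_n) : Prop := psdmx (B - A).

(** functional calculus via the spectral decomposition of a normal matrix
    A = P^-1 diag(l) P (P unitary); f is applied to the (real) eigenvalues *)
Definition mxfun n (f : R -> R) (A : 'M[C]_n) : 'M[C]_n :=
  invmx (spectralmx A) *m
  diag_mx (map_mx (fun l : C => let: Complex r _ := l in RtoC (f r)) (spectral_diag A)) *m
  spectralmx A.

(** power on the support: l |-> l^t for l > 0, 0 for l = 0
    (so negative powers are generalized inverses) *)
Definition rpow (t : R) (l : R) : R := if 0 < l then powR l t else 0.

Definition log2 (x : R) : R := ln x / ln 2.

Definition log2supp (l : R) : R := if 0 < l then log2 l else 0.

Definition log2e (x : R) : \bar R := if 0 < x then (log2 x)%:E else -oo%E.

Definition log2E (x : \bar R) : \bar R :=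
  match x with
  | +oo%E => +oo%E
  | -oo%E => -oo%E
  | EFin r => log2e r
  end.

Definition supp_incl n (rho sigma : 'M[C]_n) : Prop :=
  forall v : 'cV[C]_n, sigma *m v = 0 -> rho *m v = 0.

Definition Dsand n (a : R) (rho sigma : 'M[C]_n) : \bar R :=
  if (1 < a) && ~~ `[< supp_incl rho sigma >] then +oo%E
  else
    let S := mxfun (rpow ((1 - a) / (2 * a))) sigma in
    (((a - 1)^-1)%:E * log2e (ReC (\tr (mxfun (rpow a) (S *m rho *m S)))))%E.

Definition Dumegaki n (rho sigma : 'M[C]_n) : \bar R :=
  if `[< supp_incl rho sigma >] then
    (ReC (\tr (rho *m (mxfun log2supp rho - mxfun log2supp sigma))))%:E
  else +oo%E.

Definition Dmax n (rho sigma : 'M[C]_n) : \bar R :=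
  log2E (ereal_inf [set mu%:E | mu in
                      [set mu : R | loewner rho (RtoC mu *: sigma)]]).

Definition Dsandwiched n (a : \bar R) (rho sigma : 'M[C]_n) : \bar R :=
  match a with
  | +oo%E => Dmax rho sigma
  | EFin r => if r == 1 then Dumegaki rho sigma else Dsand r rho sigma
  | -oo%E => +oo%E (* not used *)
  end.

Definition Isand m d (a : \bar R) (rhoX : 'M[C]_m) (rhoXA : 'M[C]_(m * d))
  : \bar R :=
  ereal_inf [set Dsandwiched a rhoXA (rhoX *t sigma) | sigma in
              [set s : 'M[C]_d | density s]].

Definition ketbra (X : finType) (x : X) : 'M[C]_#|X| :=
  delta_mx (enum_rank x) (enum_rank x).

Definition cq_state (X : finType) d (p : X -> R) (rho : X -> 'M[C]_d)
  : 'M[C]_(#|X| * d) :=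
  \sum_(x : X) RtoC (p x) *: (ketbra x *t rho x).

Definition cq_marginal (X : finType) (p : X -> R) : 'M[C]_#|X| :=
  \sum_(x : X) RtoC (p x) *: ketbra x.

Definition pmf (X : finType) : set (X -> R) :=
  [set pi | (forall x, 0 <= pi x) /\ \sum_(x : X) pi x = 1].

Definition Bquant (X : finType) d (rho : X -> 'M[C]_d) : \bar R :=
  ereal_inf [set \big[maxe/-oo%E]_(x : X)
                   Dmax (rho x) (\sum_(x' : X) RtoC (pi x') *: rho x')
            | pi in @pmf X].

Definition Rquant (X : finType) d (rho : X -> 'M[C]_d) : \bar R :=
  \big[maxe/-oo%E]_(x : X) \big[maxe/-oo%E]_(x' : X) Dmax (rho x) (rho x').

End QuantumRenyi.

(* Main.v *)
Require Import Defs.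
From HB Require Import structures.
From mathcomp Require Import all_boot all_order all_algebra.
From mathcomp Require Import all_classical all_reals all_analysis.
From mathcomp Require Import complex mxtens ring lra.

Set Implicit Arguments.
Unset Strict Implicit.
Unset Printing Implicit Defensive.

Import Order.TTheory GRing.Theory Num.Theory.
Local Open Scope ring_scope.

(** A bound [rho <= 2^r sigma] is equivalent to [Dmax rho sigma <= r], so the
    second inequality is the positivity of a sum of tensor products of
    positive matrices, and the third one is the choice of a point mass.

    For the first one, let [0 <= M <= N] with eigenvectors [u_i], [w_j] and
    eigenvalues [l_i], [k_j], and put [c_ij = |<u_i, w_j>|^2].  Testing
    [M <= N] on [N^-1 u_i] gives [\sum_j c_ij / k_j <= 1 / l_i].  Jensen's
    inequality in the variable [1 / k] then compares [h (l_i)] with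
    [<u_i, h(N) u_i>] for every [h] that is monotone and convex (or concave)
    in that variable, hence [\tr (M h(M))] with [\tr (M h(N))].  Applied to
    [M = S rho S], [N = 2^r S sigma S], [S = sigma^((1-a)/2a)] and
    [h = t^(a-1)] (or to [rho], [2^r sigma] and [h = ln] when [a = 1]), this
    bounds the order-[a] divergence by [r], without using operator
    monotonicity. *)

(** * Reals inside the complex field, and squared moduli *)

Section Scalars.
Variable R : realType.
Local Notation C := R[i].

HB.instance Definition _ :=
  GRing.RMorphism.copy (@RtoC R) (real_complex R).

Definition sqnorm (z : C) : R := ReC (z * Num.conj z).

Lemma RtoC_ge0 (x : R) : (0 <= RtoC x) = (0 <= x).
Proof. exact: ler0c. Qed.

Lemma RtoC_inj : injective (@RtoC R).
Proof. by move=> x y []. Qed.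

Lemma conj_RtoC (x : R) : Num.conj (RtoC x) = RtoC x.
Proof. exact: conjc_real. Qed.

Lemma ReC_RtoC (x : R) : ReC (RtoC x) = x. Proof. by []. Qed.

Lemma ge0_RtoC (z : C) : 0 <= z -> z = RtoC (ReC z).
Proof. by case: z => x y; rewrite lecE /= => /andP[/eqP -> _]. Qed.

Lemma sqnormE (z : C) : RtoC (sqnorm z) = z * Num.conj z.
Proof. by rewrite /sqnorm -ge0_RtoC // mul_conjC_ge0. Qed.

Lemma sqnorm_ge0 (z : C) : 0 <= sqnorm z.
Proof. by rewrite -RtoC_ge0 sqnormE mul_conjC_ge0. Qed.

Lemma sqnorm_RtoC (x : R) : sqnorm (RtoC x) = x ^+ 2.
Proof. by apply: RtoC_inj; rewrite sqnormE conj_RtoC rmorphXn expr2. Qed.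

End Scalars.

(** * Adjoints and the cone of positive semi-definite matrices *)

Section Adjoint.
Variable R : realType.
Local Notation C := R[i].

Lemma adjmxM m n p (A : 'M[C]_(m, n)) (B : 'M[C]_(n, p)) :
  adjmx (A *m B) = adjmx B *m adjmx A.
Proof. by rewrite /adjmx trmx_mul map_mxM. Qed.

Lemma adjmxK m n (A : 'M[C]_(m, n)) : adjmx (adjmx A) = A.
Proof. exact: trmxCK. Qed.

Lemma adjmxE m n (A : 'M[C]_(m, n)) i j : adjmx A i j = Num.conj (A j i).
Proof. by rewrite !mxE. Qed.

Lemma adjmxD m n (A B : 'M[C]_(m, n)) : adjmx (A + B) = adjmx A + adjmx B.
Proof. by rewrite /adjmx linearD map_mxD. Qed.

Lemma adjmxB m n (A B : 'M[C]_(m, n)) : adjmx (A - B) = adjmx A - adjmx B.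
Proof. by rewrite /adjmx linearB map_mxB. Qed.

Lemma adjmxZ m n (x : R) (A : 'M[C]_(m, n)) :
  adjmx (RtoC x *: A) = RtoC x *: adjmx A.
Proof. by rewrite /adjmx linearZ map_mxZ /= conj_RtoC. Qed.

Lemma adjmx_tens m n p q (A : 'M[C]_(m, n)) (B : 'M[C]_(p, q)) :
  adjmx (A *t B) = adjmx A *t adjmx B.
Proof. by rewrite /adjmx trmx_tens map_mxT. Qed.

Lemma gram_diag m n (A : 'M[C]_(m, n)) j :
  (adjmx A *m A) j j = RtoC (\sum_i sqnorm (A i j)).
Proof.
rewrite mxE rmorph_sum; apply: eq_bigr => i _ /=.
by rewrite adjmxE sqnormE mulrC.
Qed.

Lemma gram_col_eq0 n (v : 'cV[C]_n) : (adjmx v *m v) 0 0 = 0 -> v = 0.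
Proof.
rewrite gram_diag -[RHS](rmorph0 (@RtoC R)) => /RtoC_inj /eqP.
rewrite psumr_eq0 => [/allP v0|i _]; last exact: sqnorm_ge0.
apply/matrixP => i j; rewrite ord1 mxE; apply/eqP.
have /eqP := v0 i (mem_index_enum _).
move=> /(congr1 (@RtoC R)); rewrite sqnormE rmorph0 => /eqP.
by rewrite mul_conjC_eq0.
Qed.

Lemma psdmx_gram m n (B : 'M[C]_(m, n)) : psdmx (adjmx B *m B).
Proof.
split=> [|v]; first by rewrite adjmxM adjmxK.
rewrite mulmxA -adjmxM -mulmxA gram_diag RtoC_ge0.
by apply: sumr_ge0 => i _; exact: sqnorm_ge0.
Qed.

Lemma psdmx_congr m n (A : 'M[C]_n) (B : 'M[C]_(n, m)) :
  psdmx A -> psdmx (adjmx B *m A *m B).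
Proof.
move=> [Ah Ap]; split=> [|v]; first by rewrite !adjmxM adjmxK -Ah mulmxA.
by have := Ap (B *m v); rewrite adjmxM !mulmxA.
Qed.

Lemma psdmx0 n : psdmx (0 : 'M[C]_n).
Proof.
split=> [|v]; first by rewrite /adjmx linear0 map_mx0.
by rewrite mulmx0 mul0mx mxE.
Qed.

Lemma psdmxD n (A B : 'M[C]_n) : psdmx A -> psdmx B -> psdmx (A + B).
Proof.
move=> [Ah Ap] [Bh Bp]; split=> [|v]; first by rewrite adjmxD -Ah -Bh.
by rewrite mulmxDr mulmxDl mxE addr_ge0.
Qed.

Lemma psdmxZ n (x : R) (A : 'M[C]_n) :
  0 <= x -> psdmx A -> psdmx (RtoC x *: A).
Proof.
move=> x0 [Ah Ap]; split=> [|v]; first by rewrite adjmxZ -Ah.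
by rewrite -scalemxAr -scalemxAl mxE mulr_ge0 // RtoC_ge0.
Qed.

Lemma psdmx_sum (I : finType) n (F : I -> 'M[C]_n) :
  (forall i, psdmx (F i)) -> psdmx (\sum_i F i).
Proof. by move=> Fp; apply: big_ind => [|A B|i _]; [exact: psdmx0|exact: psdmxD|]. Qed.

End Adjoint.

(** * Spectral decompositions and overlaps of eigenbases *)

Section SpectralForm.
Variable R : realType.
Local Notation C := R[i].

Definition specmx n (U : 'M[C]_n) (l : 'I_n -> R) : 'M[C]_n :=
  adjmx U *m diag_mx (\row_i RtoC (l i)) *m U.

(** The weight [c_ij] between the [i]-th column of [adjmx U] and the [j]-th column of [adjmx W];
    these columns are the eigenvectors in [specmx]. *)
Definition overlap n (U W : 'M[C]_n) (i j : 'I_n) : R :=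
  sqnorm ((U *m adjmx W) i j).

Lemma overlap_ge0 n (U W : 'M[C]_n) i j : 0 <= overlap U W i j.
Proof. exact: sqnorm_ge0. Qed.

Lemma adjmx_specmx n (U : 'M[C]_n) l : adjmx (specmx U l) = specmx U l.
Proof.
rewrite /specmx !adjmxM adjmxK -mulmxA; congr (_ *m (_ *m _)).
rewrite /adjmx tr_diag_mx map_diag_mx; congr diag_mx.
by apply/rowP => i; rewrite !mxE /= conj_RtoC.
Qed.

Lemma eq_specmx n (U : 'M[C]_n) l k : l =1 k -> specmx U l = specmx U k.
Proof.
by move=> lk; congr (_ *m diag_mx _ *m _); apply/rowP => i; rewrite !mxE lk.
Qed.

Lemma specmxZ n (U : 'M[C]_n) x l :
  RtoC x *: specmx U l = specmx U (fun i => x * l i).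
Proof.
rewrite /specmx scalemxAl scalemxAr -linearZ; congr (_ *m diag_mx _ *m _).
by apply/rowP => i; rewrite !mxE rmorphM.
Qed.

Lemma quad_specmx n (U : 'M[C]_n) l (v : 'cV[C]_n) :
  (adjmx v *m specmx U l *m v) 0 0 =
  RtoC (\sum_i l i * sqnorm ((U *m v) i 0)).
Proof.
rewrite /specmx !mulmxA -adjmxM -mulmxA mxE rmorph_sum.
apply: eq_bigr => i _; rewrite mul_mx_diag 2!mxE rmorphM /= sqnormE mxE.
by rewrite [_^T _ _]mxE; ring.
Qed.

Lemma mxtrace_specmx_mul n (U W : 'M[C]_n) l k :
  \tr (specmx U l *m specmx W k) =
  RtoC (\sum_i l i * \sum_j overlap U W i j * k j).
Proof.
pose D l := diag_mx (\row_i RtoC (l i)) : 'M[C]_n.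
(* By cyclicity only the change of basis [U *m adjmx W] remains between the two diagonal
   matrices. *)
have -> : \tr (specmx U l *m specmx W k) =
    \tr ((adjmx (U *m adjmx W) *m D l) *m (U *m adjmx W *m D k)).
  by rewrite adjmxM adjmxK /specmx !mulmxA mxtrace_mulC !mulmxA.
rewrite /mxtrace rmorph_sum.
under eq_bigr do rewrite mxE.
rewrite exchange_big; apply: eq_bigr => i _ /=.
rewrite rmorphM rmorph_sum mulr_sumr; apply: eq_bigr => j _ /=.
rewrite !mul_mx_diag mxE [X in _ * X = _]mxE.
rewrite rmorphM /overlap /= sqnormE.
rewrite !mxE /=; ring.
Qed.

Lemma unitary_mul_adj n (U : 'M[C]_n) : U \is unitarymx -> U *m adjmx U = 1%:M.
Proof. exact: unitarymxP. Qed.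

Lemma unitary_adj_mul n (U : 'M[C]_n) : U \is unitarymx -> adjmx U *m U = 1%:M.
Proof. by move=> /unitary_mul_adj /mulmx1C. Qed.

Lemma specmxM n (U : 'M[C]_n) l k : U \is unitarymx ->
  specmx U l *m specmx U k = specmx U (fun i => l i * k i).
Proof.
move=> Uu; rewrite /specmx !mulmxA -(mulmxA _ U) unitary_mul_adj // mulmx1.
rewrite -(mulmxA (adjmx U)) mulmx_diag; congr (_ *m diag_mx _ *m _).
by apply/rowP => i; rewrite !mxE rmorphM.
Qed.

Lemma mxtrace_specmx n (U : 'M[C]_n) l : U \is unitarymx ->
  \tr (specmx U l) = RtoC (\sum_i l i).
Proof.
move=> Uu; rewrite /specmx mxtrace_mulC mulmxA unitary_mul_adj // mul1mx.
by rewrite mxtrace_diag rmorph_sum; apply: eq_bigr => i _; rewrite mxE.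
Qed.

Lemma sum_overlap n (U W : 'M[C]_n) i :
  U \is unitarymx -> W \is unitarymx -> \sum_j overlap U W i j = 1.
Proof.
move=> Uu Wu; apply: RtoC_inj; rewrite rmorph1.
have TT : (U *m adjmx W) *m adjmx (U *m adjmx W) = 1%:M.
  rewrite adjmxM adjmxK mulmxA -(mulmxA U) unitary_adj_mul // mulmx1.
  exact: unitary_mul_adj.
have /matrixP/(_ i i) := TT; rewrite mxE [RHS]mxE eqxx mulr1n => <-.
rewrite rmorph_sum.
by apply: eq_bigr => j _ /=; rewrite /overlap sqnormE adjmxE.
Qed.

Lemma psdmx_diag_ge0 n (A : 'M[C]_n) i : psdmx A -> 0 <= A i i.
Proof.
move=> [_ /(_ (delta_mx i 0))]; rewrite -mulmxA -colE mxE (bigD1 i) //=.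
rewrite big1 => [|j ji]; first by rewrite !mxE !eqxx conjC1 mul1r addr0.
by rewrite !mxE (negbTE ji) conjC0 mul0r.
Qed.

(** One pair [U], [l] serves [A] and all its functions [mxfun f A], so functional calculus becomes
    arithmetic on [l]. *)
Lemma psdmx_spectral n (A : 'M[C]_n) : psdmx A ->
  exists (U : 'M[C]_n) (l : 'I_n -> R),
  [/\ U \is unitarymx, forall i, 0 <= l i, A = specmx U l
    & forall f, mxfun f A = specmx U (f \o l)].
Proof.
move=> Ap; have Uu := spectral_unitarymx A; set U := spectralmx A in Uu *.
have invU : invmx U = adjmx U by exact: invmx_unitary.
have AE : A = adjmx U *m diag_mx (spectral_diag A) *m U.
  rewrite -invU; apply/orthomx_spectralP/normalmxP.
  by have -> : map_mx Num.conj A^T = A by have [/esym] := Ap.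
(* The eigenvalues are the diagonal entries of the positive matrix [U *m A *m adjmx U]. *)
have sp0 i : 0 <= spectral_diag A 0 i.
  have := psdmx_diag_ge0 i (psdmx_congr (adjmx U) Ap).
  rewrite adjmxK {1}AE !mulmxA unitary_mul_adj // mul1mx -mulmxA.
  by rewrite unitary_mul_adj // mulmx1 !mxE eqxx.
have spE i : spectral_diag A 0 i = RtoC (ReC (spectral_diag A 0 i)).
  exact: ge0_RtoC.
exists U, (fun i => ReC (spectral_diag A 0 i)); split.
- exact: Uu.
- by move=> i; rewrite -RtoC_ge0 -spE.
- rewrite [LHS]AE; congr (_ *m diag_mx _ *m _).
  by apply/rowP => i; rewrite !mxE [LHS]spE.
- move=> f; rewrite /mxfun -/U invU; congr (_ *m diag_mx _ *m _).
  by apply/rowP => i; rewrite !mxE [in LHS]spE.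
Qed.

Local Opaque specmx.

Lemma psdmx_gramP n (A : 'M[C]_n) :
  psdmx A -> exists B : 'M[C]_n, A = adjmx B *m B.
Proof.
move=> /psdmx_spectral[U [l [Uu l0 -> _]]].
exists (specmx U (fun i => Num.sqrt (l i))).
rewrite adjmx_specmx specmxM //; apply: eq_specmx => i.
by rewrite -expr2 sqr_sqrtr.
Qed.

(** Write [A] as [adjmx S *m S]: if [B *m v = 0], the inequality at [v] says that the squared norm
    of [S *m v] is at most 0. *)
Lemma loewner_supp_incl n (A B : 'M[C]_n) (x : R) :
  psdmx A -> loewner A (RtoC x *: B) -> supp_incl A B.
Proof.
move=> /psdmx_gramP[S ->] [_ le_AB] v Bv; have := le_AB v.
rewrite -mulmxA mulmxBl -scalemxAl Bv scaler0 sub0r mulmxN mxE oppr_ge0.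
rewrite !mulmxA -adjmxM -!mulmxA => Sv_le0.
suff -> : S *m v = 0 by rewrite mulmx0.
apply: gram_col_eq0; apply/eqP; rewrite eq_le Sv_le0 gram_diag RtoC_ge0.
by apply: sumr_ge0 => i _; exact: sqnorm_ge0.
Qed.

(** * Overlap averages when one matrix dominates another *)

Section Domination.
Variables (n : nat) (U W : 'M[C]_n) (l k : 'I_n -> R).
Hypotheses (Uu : U \is unitarymx) (Wu : W \is unitarymx).
Hypotheses (l0 : forall i, 0 <= l i) (k0 : forall j, 0 <= k j).
Hypothesis le_lk : loewner (specmx U l) (specmx W k).

(** The inequality is tested on the vector with coordinates [y] in the eigenbasis of the larger
    matrix; on the smaller side only the [i]-th nonnegative term is kept. *)
Lemma loewner_specmx_quad i (y : 'cV[C]_n) :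
  l i * sqnorm ((U *m adjmx W *m y) i 0) <= \sum_j k j * sqnorm (y j 0).
Proof.
have [_ /(_ (adjmx W *m y))] := le_lk.
rewrite mulmxBr mulmxBl mxE [X in _ + X]mxE !quad_specmx -rmorphB RtoC_ge0.
rewrite subr_ge0 [W *m _]mulmxA unitary_mul_adj // mul1mx mulmxA.
apply: le_trans; rewrite (bigD1 i) //= lerDl.
by apply: sumr_ge0 => j _; rewrite mulr_ge0 // sqnorm_ge0.
Qed.

(** Testing on the [j]-th eigenvector gives [l i * overlap U W i j <= k j]. Hence the default values
    of [rpow] and [log2supp] at 0 never enter an average. *)
Lemma overlap_eq0 i j : 0 < l i -> k j = 0 -> overlap U W i j = 0.
Proof.
move=> li kj; have := loewner_specmx_quad i (delta_mx j 0).
rewrite -colE mxE -/(overlap U W i j) big1 => [|j' _].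
  rewrite pmulr_rle0 // => le0; apply/eqP.
  by rewrite eq_le le0 overlap_ge0.
rewrite mxE andbT; case: eqP => [->|_]; first by rewrite kj mul0r.
by rewrite mulr0n -(rmorph0 (@RtoC R)) sqnorm_RtoC expr0n mulr0.
Qed.

(* With y the coordinates of N^-1 u_i in the eigenbasis of N, comparing the
   quadratic forms at y reads [l i * x ^+ 2 <= x], x being the left side. *)
Lemma sum_overlap_inv i : 0 < l i ->
  \sum_j overlap U W i j / k j <= (l i)^-1.
Proof.
move=> li; set x := \sum_j _.
pose T := U *m adjmx W.
have x0 : 0 <= x by apply: sumr_ge0 => j _; rewrite divr_ge0 // overlap_ge0.
have := loewner_specmx_quad i (\col_j (Num.conj (T i j) * RtoC (k j)^-1)).
have -> : (U *m adjmx W *m \col_j (Num.conj (T i j) * RtoC (k j)^-1)) i 0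
    = RtoC x.
  rewrite mxE rmorph_sum; apply: eq_bigr => j _ /=.
  by rewrite [X in _ * X]mxE mulrA -sqnormE -rmorphM.
have -> : \sum_j k j * sqnorm ((\col_j (Num.conj (T i j) * RtoC (k j)^-1)) j 0)
    = x.
  apply: eq_bigr => j _; rewrite mxE.
  have -> : sqnorm (Num.conj (T i j) * RtoC (k j)^-1) =
      overlap U W i j * (k j)^-1 ^+ 2.
    apply: RtoC_inj; rewrite rmorphM rmorphXn /overlap !sqnormE rmorphM.
    by rewrite /= conj_RtoC conjCK sqnormE; ring.
  (* For [k j = 0] the convention [0^-1 = 0] makes both sides vanish. *)
  have [->|kj] := eqVneq (k j) 0; first by rewrite invr0 mul0r mulr0.
  by field.
rewrite sqnorm_RtoC expr2 mulrA => le_x.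
have [->|x_neq0] := eqVneq x 0; first by rewrite invr_ge0 ltW.
have x_gt0 : 0 < x by rewrite lt_def x_neq0.
by rewrite -[(l i)^-1]mul1r ler_pdivlMr // mulrC -(ler_pM2r x_gt0) mul1r.
Qed.

(* Jensen's inequality in the variable [1 / k j]: a lower bound for [g] by an
   affine function of that variable, decreasing from the value [b] at
   [1 / l i], integrates against the weights [overlap U W i]. *)
Lemma overlap_jensen i (b c : R) (g : 'I_n -> R) : 0 < l i -> 0 <= c ->
  (forall j, 0 < k j -> b + c * (1 - l i / k j) <= g j) ->
  b <= \sum_j overlap U W i j * g j.
Proof.
move=> li c0 bg.
apply: (@le_trans _ _ (\sum_j overlap U W i j * (b + c * (1 - l i / k j)))).
  under eq_bigr do rewrite mulrDr.
  rewrite big_split /= -mulr_suml sum_overlap // mul1r lerDl.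
  rewrite (eq_bigr (fun j => c * (overlap U W i j)
      - c * l i * (overlap U W i j / k j))); last by move=> j _; ring.
  rewrite sumrB -!mulr_sumr sum_overlap // -mulrA -mulrBr mulr_ge0 //.
  rewrite subr_ge0 mulrC -ler_pdivlMr // mul1r.
  exact: sum_overlap_inv.
apply: ler_sum => j _; have [kj|kj] := ltP 0 (k j).
  by rewrite ler_wpM2l ?overlap_ge0 // bg.
by rewrite overlap_eq0 ?mul0r //; apply/eqP; rewrite eq_le kj k0.
Qed.

(** Jensen with slope 0, applied to [g] and to [- g]. *)
Lemma overlap_average i (b : R) (g : 'I_n -> R) : 0 < l i ->
  (forall j, 0 < k j -> g j = b) -> \sum_j overlap U W i j * g j = b.
Proof.
move=> li gb; apply/eqP; rewrite eq_le; apply/andP; split; last first.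
  by apply: (overlap_jensen (c := 0)) => // j /gb ->; rewrite mul0r addr0.
rewrite -lerN2 -sumrN; under eq_bigr do rewrite -mulrN.
by apply: (overlap_jensen (c := 0)) => // j /gb ->; rewrite mul0r addr0.
Qed.

End Domination.

End SpectralForm.

(** * Tangent-line inequalities in the variable [1 / y] *)

Section TangentLines.
Variable R : realType.
Implicit Types x y p r : R.

Lemma ln_tangent x y : 0 < x -> 0 < y -> ln x + (1 - x / y) <= ln y.
Proof.
move=> x0 y0; have : ln (1 + (x / y - 1)) <= x / y - 1.
  by apply: le_ln1Dx; rewrite ltrBrDl subrr divr_gt0.
by rewrite addrC subrK ln_div ?posrE //; lra.
Qed.

Lemma powR_expR x p : 0 < x -> x `^ p = expR (p * ln x).
Proof. by move=> x0; rewrite /powR gt_eqF. Qed.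

Lemma powR_mul_pred x p : 0 < x -> x `^ p = x * x `^ (p - 1).
Proof.
move=> x0; rewrite -{2}[x]powRr1 ?ltW // -powRD ?subrKC //.
by rewrite (gt_eqF x0) implybT.
Qed.

(** With [s = 1 / y], the function [s^(-p)] is convex and the left side is its tangent at
    [1 / x]. *)
Lemma powR_tangent x y p : 0 <= p -> 0 < x -> 0 < y ->
  x `^ p + p * x `^ p * (1 - x / y) <= y `^ p.
Proof.
move=> p0 x0 y0; rewrite !powR_expR //.
have -> : expR (p * ln y) = expR (p * ln x) * expR (p * (ln y - ln x)).
  by rewrite -expRD; congr expR; ring.
rewrite -mulrA mulrCA -{1}[expR (p * ln x)]mulr1 -mulrDr.
rewrite ler_wpM2l ?expR_ge0 //; apply: le_trans (expR_ge1Dx _).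
by rewrite lerD2l ler_wpM2l // lerBrDl ln_tangent.
Qed.

(* Convexity of [expR]: both [expR z] and [1] lie above its tangent at
   [r * z]. *)
Lemma expR_convex_comb r (z : R) : 0 <= r <= 1 ->
  expR (r * z) <= r * expR z + (1 - r).
Proof.
move=> /andP[r0 r1]; set m := r * z.
have zE : expR z = expR m * expR (z - m) by rewrite -expRD; congr expR; ring.
have e1 : expR m * expR (- m) = 1 by rewrite -expRD subrr expR0.
rewrite zE -[X in _ + X]mulr1 -[X in _ + _ * X]e1 !(mulrCA _ (expR m)) -mulrDr.
rewrite -{1}[expR m]mulr1 ler_wpM2l ?expR_ge0 //.
(* Since [m = r * z], the linear terms cancel and this combination equals 1. *)
apply: (@le_trans _ _ (r * (1 + (z - m)) + (1 - r) * (1 + - m))).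
  by rewrite le_eqVlt /m; apply/orP; left; apply/eqP; ring.
by apply: lerD; rewrite ler_wpM2l ?subr_ge0 ?expR_ge1Dx.
Qed.

(** Here [-p] lies in [0, 1], so [s^(-p)] is concave in [s = 1 / y] and lies below its tangent at
    [1 / x]. *)
Lemma powR_neg_tangent x y p : -1 <= p <= 0 -> 0 < x -> 0 < y ->
  y `^ p <= x `^ p + p * x `^ p * (1 - x / y).
Proof.
move=> /andP[p1 p0] x0 y0; rewrite !powR_expR //.
have -> : expR (p * ln y) = expR (p * ln x) * expR (- p * (ln x - ln y)).
  by rewrite -expRD; congr expR; ring.
rewrite -mulrA mulrCA -{2}[expR (p * ln x)]mulr1 -mulrDr.
rewrite ler_wpM2l ?expR_ge0 //.
have -> : x / y = expR (ln x - ln y) by rewrite expRB !lnK.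
apply: le_trans (expR_convex_comb _ _) _; first by lra.
by rewrite le_eqVlt; apply/orP; left; apply/eqP; ring.
Qed.

End TangentLines.

(** * Bounds on divergences of finite order from an operator inequality *)

Section RenyiBound.
Variable R : realType.
Local Notation C := R[i].

Lemma rpow_gt0 (p x : R) : 0 < x -> rpow p x = x `^ p.
Proof. by rewrite /rpow => ->. Qed.

Lemma rpow0 (p : R) : rpow p 0 = 0.
Proof. by rewrite /rpow ltxx. Qed.

Lemma rpow_ge0 (p x : R) : 0 <= rpow p x.
Proof. by rewrite /rpow; case: ifP => // _; exact: powR_ge0. Qed.

Definition sandwich n (a : R) (rho tau : 'M[C]_n) : 'M[C]_n :=
  mxfun (rpow ((1 - a) / (2 * a))) tau *m rho
    *m mxfun (rpow ((1 - a) / (2 * a))) tau.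

Variables (n : nat) (rho tau : 'M[C]_n) (mu : R).
Hypotheses (rhoD : density rho) (tauP : psdmx tau) (mu0 : 0 < mu).
Hypothesis le_rho : loewner rho (RtoC mu *: tau).

(** With [M = S rho S] and [N = mu S tau S], the exponents cancel: [S N^(a-1) S] is [mu^(a-1)] times
    the projector onto the support of [tau]. This support contains that of [rho], so the trace of
    [M N^(a-1)] is [mu^(a-1)]. *)
Lemma sandwich_spectral (a : R) : 0 < a ->
  exists (U W : 'M[C]_n) (l k : 'I_n -> R),
  [/\ [/\ U \is unitarymx, W \is unitarymx, forall i, 0 <= l i
        & forall j, 0 <= k j],
      loewner (specmx U l) (specmx W k),
      ReC (\tr (mxfun (rpow a) (sandwich a rho tau))) = \sum_i rpow a (l i)
    & \sum_i l i * (\sum_j overlap U W i j * rpow (a - 1) (k j))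
      = mu `^ (a - 1)].
Proof.
move=> a0; have [rhoP rho1] := rhoD; rewrite /sandwich; set S := mxfun _ tau.
have [W [t [Wu t0 tauE fE]]] := psdmx_spectral tauP.
pose s j := rpow ((1 - a) / (2 * a)) (t j).
have SE : S = specmx W s by rewrite /S fE.
clearbody S.
have Sadj : adjmx S = S by rewrite SE adjmx_specmx.
have MP : psdmx (S *m rho *m S) by rewrite -{1}Sadj; exact: psdmx_congr.
have [U [l [Uu l0 ME gE]]] := psdmx_spectral MP.
pose k j := mu * (s j * t j * s j).
have s0 j : 0 <= s j by exact: rpow_ge0.
have kE : specmx W k = S *m (RtoC mu *: tau) *m S.
  by rewrite -scalemxAr -scalemxAl SE tauE !specmxM // specmxZ.
exists U, W, l, k; split.
- by split=> // j; rewrite /k !mulr_ge0 // ltW.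
- rewrite /loewner -ME kE -mulmxBl -mulmxBr -{1}Sadj; exact: psdmx_congr.
- by rewrite gE mxtrace_specmx.
have [V [r [Vu r0 rhoE _]]] := psdmx_spectral rhoP.
apply: RtoC_inj; rewrite -mxtrace_specmx_mul -ME -!mulmxA mxtrace_mulC.
rewrite SE specmxM // -mulmxA specmxM // rhoE mxtrace_specmx_mul.
congr RtoC; rewrite (eq_bigr (fun i => r i * mu `^ (a - 1))).
  rewrite -mulr_suml.
  have -> : \sum_i r i = 1.
    by apply: RtoC_inj; rewrite -(mxtrace_specmx _ Vu) -rhoE rmorph1.
  by rewrite mul1r.
move=> i _; have [ri|ri] := ltP 0 (r i); last first.
  by have -> : r i = 0; [apply/eqP; rewrite eq_le ri r0 | rewrite !mul0r].
congr (_ * _).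
(* The averaged function is constant on the support of [tau], and [rho <= mu tau] removes the other
   indices. *)
apply: (overlap_average (k := fun j => mu * t j) Vu Wu r0 _ _ ri).
- by move=> j; rewrite mulr_ge0 // ltW.
- by rewrite -specmxZ -tauE -rhoE.
move=> j; rewrite pmulr_rgt0 // => tj.
have sj : 0 < s j by rewrite /s rpow_gt0 // powR_gt0.
have kj : 0 < k j by rewrite /k !mulr_gt0.
rewrite rpow_gt0 //.
(* Taking logarithms reduces the cancellation of powers to a linear identity. *)
apply: ln_inj; rewrite ?posrE ?mulr_gt0 ?powR_gt0 //.
rewrite !lnM ?posrE ?mulr_gt0 ?powR_gt0 // !ln_powR.
rewrite /k !lnM ?posrE ?mulr_gt0 // /s rpow_gt0 // ln_powR.
by field; rewrite gt_eqF.
Qed.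

Lemma sandwich_trace_le (a : R) : 1 < a ->
  ReC (\tr (mxfun (rpow a) (sandwich a rho tau))) <= mu `^ (a - 1).
Proof.
move=> a1; have a0 : 0 < a by lra.
have [U [W [l [k [[Uu Wu l0 k0] le_lk -> <-]]]]] := sandwich_spectral a0.
apply: ler_sum => i _; have [li|li] := ltP 0 (l i); last first.
  have -> : l i = 0 by apply/eqP; rewrite eq_le li l0.
  by rewrite rpow0 mul0r.
rewrite rpow_gt0 // powR_mul_pred // ler_wpM2l //.
(* The slope is that of [powR_tangent] at [l i] with exponent [a - 1]. *)
apply: (overlap_jensen Uu Wu l0 k0 le_lk li (c := (a - 1) * l i `^ (a - 1))).
  by rewrite mulr_ge0 ?powR_ge0 //; lra.
by move=> j kj; rewrite rpow_gt0 // powR_tangent //; lra.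
Qed.

Lemma sandwich_trace_ge (a : R) : 0 < a < 1 ->
  mu `^ (a - 1) <= ReC (\tr (mxfun (rpow a) (sandwich a rho tau))).
Proof.
move=> /andP[a0 a1].
have [U [W [l [k [[Uu Wu l0 k0] le_lk -> <-]]]]] := sandwich_spectral a0.
apply: ler_sum => i _; have [li|li] := ltP 0 (l i); last first.
  have -> : l i = 0 by apply/eqP; rewrite eq_le li l0.
  by rewrite rpow0 mul0r.
(* For [a < 1] the power is concave in [1 / k j], so Jensen is applied to its negative. *)
rewrite rpow_gt0 // powR_mul_pred // ler_wpM2l // -lerN2 -sumrN.
under eq_bigr do rewrite -mulrN.
apply: (overlap_jensen Uu Wu l0 k0 le_lk li (c := (1 - a) * l i `^ (a - 1))).
  by rewrite mulr_ge0 ?powR_ge0 //; lra.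
move=> j kj; rewrite rpow_gt0 // lerNr.
apply: le_trans (powR_neg_tangent _ li kj) _; first by lra.
by rewrite le_eqVlt; apply/orP; left; apply/eqP; ring.
Qed.

Lemma ln2_gt0 : 0 < ln 2 :> R.
Proof. by rewrite ln_gt0 // ltr1n. Qed.

Lemma Dsand_le (a : R) : 0 < a -> a != 1 ->
  (Dsand a rho tau <= (log2 mu)%:E)%E.
Proof.
move=> a0 a1; rewrite /Dsand.
have -> : `[< supp_incl rho tau >] = true.
  apply/asboolP; apply: loewner_supp_incl le_rho; exact: (proj1 rhoD).
rewrite andbF /=; set Q := ReC (\tr (mxfun _ (sandwich a rho tau))).
have QE : 0 < Q -> (((a - 1)^-1)%:E * log2e Q = ((a - 1)^-1 * log2 Q)%:E)%E.
  by rewrite /log2e => ->.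
have [{}a1|{}a1|/eqP] := ltgtP a 1; last by rewrite (negbTE a1).
- have leQ : mu `^ (a - 1) <= Q by apply: sandwich_trace_ge; rewrite a0.
  (* Positivity is essential: at [Q = 0] the negative prefactor would turn [-oo] into [+oo]. *)
  have Q0 : 0 < Q by apply: lt_le_trans leQ; exact: powR_gt0.
  rewrite QE // lee_fin /log2 mulrA ler_pM2r ?invr_gt0 ?ln2_gt0 //.
  rewrite mulrC ler_ndivrMr ?subr_lt0 // mulrC -ln_powR.
  by rewrite ler_ln ?posrE ?powR_gt0.
- have leQ : Q <= mu `^ (a - 1) by exact: sandwich_trace_le.
  have a10 : 0 < a - 1 by rewrite subr_gt0.
  have [Q0|Q0] := ltP 0 Q; last first.
    by rewrite /log2e ltNge Q0 /= gt0_muleNy ?leNye // lte_fin invr_gt0.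
  rewrite QE // lee_fin /log2 mulrA ler_pM2r ?invr_gt0 ?ln2_gt0 //.
  rewrite mulrC ler_pdivrMr // mulrC -ln_powR.
  by rewrite ler_ln ?posrE ?powR_gt0.
Qed.

Lemma Dumegaki_le : (Dumegaki rho tau <= (log2 mu)%:E)%E.
Proof.
have [rhoP rho1] := rhoD; rewrite /Dumegaki.
have -> : `[< supp_incl rho tau >] = true.
  by apply/asboolP; exact: loewner_supp_incl le_rho.
have [W [t [Wu t0 tauE fE]]] := psdmx_spectral tauP.
have [V [r [Vu r0 rhoE gE]]] := psdmx_spectral rhoP.
rewrite lee_fin mulmxBr linearB /= fE gE {1 2}rhoE specmxM //.
rewrite mxtrace_specmx // mxtrace_specmx_mul -rmorphB ReC_RtoC.
have <- : (\sum_i r i) * log2 mu = log2 mu.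
  have -> : \sum_i r i = 1.
    by apply: RtoC_inj; rewrite -(mxtrace_specmx _ Vu) -rhoE rmorph1.
  by rewrite mul1r.
rewrite mulr_suml -sumrB; apply: ler_sum => i _; rewrite -mulrBr.
have [ri|ri] := ltP 0 (r i); last first.
  by have -> : r i = 0; [apply/eqP; rewrite eq_le ri r0 | rewrite !mul0r].
(* Moving [log2 mu] to the left makes [log2 (r i) - log2 mu] the value [b] for Jensen; the slope
   [(ln 2)^-1] converts [ln_tangent] to base 2. *)
rewrite ler_wpM2l // lerBlDr addrC -lerBlDr.
apply: (overlap_jensen (k := fun j => mu * t j) Vu Wu r0 _ _ ri
  (c := (ln 2)^-1)).
- by move=> j; rewrite mulr_ge0 // ltW.
- by rewrite -specmxZ -tauE -rhoE.
- by rewrite invr_ge0 ltW // ln2_gt0.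
move=> j mtj; have tj : 0 < t j by move: mtj; rewrite pmulr_rgt0.
rewrite /= /log2supp ri tj /log2 [_^-1 * _]mulrC -mulrBl -mulrDl.
rewrite ler_pM2r ?invr_gt0 ?ln2_gt0 //.
have := ln_tangent ri mtj; rewrite lnM ?posrE //; lra.
Qed.

End RenyiBound.

(** * Max-relative entropy and operator inequalities *)

Section MaxRelativeEntropy.
Variable R : realType.
Local Notation C := R[i].

(** Reduces comparisons with [Dmax], infinite values included, to real bounds, which [Dmax_leP]
    turns into operator inequalities. *)
Lemma lee_of_upper_bounds (x y : \bar R) :
  (forall r : R, y <= r%:E -> x <= r%:E)%E -> (x <= y)%E.
Proof.
case: y => [r| |] xy; [exact: xy|exact: leey|].
case: x xy => [s| |] // xy.
- by have := xy (s - 1) (leNye _); rewrite lee_fin lerBrDr gerDl ler10.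
- by have := xy 0 (leNye _).
Qed.

Lemma log2_powR (r : R) : log2 (2 `^ r) = r.
Proof. by rewrite /log2 ln_powR mulfK // gt_eqF // ln2_gt0. Qed.

Lemma log2E_le (x : \bar R) (r : R) :
  (log2E x <= r%:E)%E = (x <= (2 `^ r)%:E)%E.
Proof.
have p0 : 0 < 2 `^ r :> R by rewrite powR_gt0.
case: x => [s| |] /=; rewrite ?leye_eq ?leNye // /log2e lee_fin.
case: ltP => s0; last by rewrite leNye (le_trans s0) // ltW.
rewrite lee_fin -{1}[r]log2_powR /log2 ler_pM2r ?invr_gt0 ?ln2_gt0 //.
by rewrite ler_ln // posrE.
Qed.

Lemma loewnerP n (A B : 'M[C]_n) (x : R) : psdmx A -> psdmx B ->
  loewner A (RtoC x *: B) <->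
  forall v : 'cV[C]_n, ReC ((adjmx v *m A *m v) 0 0) <=
    x * ReC ((adjmx v *m B *m v) 0 0).
Proof.
move=> [Ah Ap] [Bh Bp].
have quadE (v : 'cV[C]_n) : (adjmx v *m (RtoC x *: B - A) *m v) 0 0 =
    RtoC (x * ReC ((adjmx v *m B *m v) 0 0) - ReC ((adjmx v *m A *m v) 0 0)).
  rewrite mulmxBr mulmxBl -scalemxAr -scalemxAl mxE [X in X + _]mxE.
  rewrite [X in _ + X]mxE rmorphB rmorphM /=.
  by rewrite -(ge0_RtoC (Ap v)) -(ge0_RtoC (Bp v)).
split=> [[_ le_AB] v|le_AB].
  by have := le_AB v; rewrite quadE RtoC_ge0 subr_ge0.
split=> [|v]; first by rewrite adjmxB adjmxZ -Ah -Bh.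
by rewrite quadE RtoC_ge0 subr_ge0.
Qed.

(** For each [v] the constraint on [mu] is a closed condition [a <= mu * b], so it passes to the
    infimum and to every larger number. *)
Lemma Dmax_leP n (rho sigma : 'M[C]_n) (r : R) : psdmx rho -> psdmx sigma ->
  (Dmax rho sigma <= r%:E)%E <-> loewner rho (RtoC (2 `^ r) *: sigma).
Proof.
move=> rhoP sigmaP; rewrite /Dmax log2E_le; set E := (X in ereal_inf X).
split=> [infE|le_rho]; last by apply: ereal_inf_lbound; exists (2 `^ r).
apply/loewnerP => // v.
set a := ReC _; set b := ReC _; rewrite leNgt; apply/negP => ltba.
have b0 : 0 <= b by rewrite -RtoC_ge0 -ge0_RtoC; apply: (proj2 sigmaP).
have lbE c : (forall mu, a <= mu * b -> c <= mu) -> c <= 2 `^ r.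
  move=> cP; rewrite -lee_fin; apply: le_trans infE.
  apply: le_ereal_inf_tmp => _ [mu le_mu <-]; rewrite lee_fin cP //.
  by have /loewnerP := le_mu; apply.
have [b_eq0|b_neq0] := eqVneq b 0.
  have : 2 `^ r + 1 <= 2 `^ r.
    apply: lbE => mu; rewrite b_eq0 mulr0 => a_le0.
    by move: ltba; rewrite b_eq0 mulr0 ltNge a_le0.
  by rewrite gerDl ler10.
have b_gt0 : 0 < b by rewrite lt_def b_neq0.
have : a / b <= 2 `^ r by apply: lbE => mu; rewrite ler_pdivrMr.
by rewrite ler_pdivrMr // leNgt ltba.
Qed.

Lemma Dsandwiched_le_Dmax n (a : \bar R) (rho sigma : 'M[C]_n) :
  (0 < a)%E -> density rho -> psdmx sigma ->
  (Dsandwiched a rho sigma <= Dmax rho sigma)%E.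
Proof.
move=> a0 rhoD sigmaP; apply: lee_of_upper_bounds => r Dr.
have le_rho : loewner rho (RtoC (2 `^ r) *: sigma).
  by apply/Dmax_leP => //; case: rhoD.
have p0 : 0 < 2 `^ r :> R by rewrite powR_gt0.
rewrite -[r]log2_powR; case: a a0 => [a| |] //=; last by rewrite log2_powR.
rewrite lte_fin => a0; case: ifPn => [_|a1]; first exact: Dumegaki_le.
exact: Dsand_le.
Qed.

End MaxRelativeEntropy.

(** * Tensor products and classical-quantum states *)

Section ClassicalQuantum.
Variable R : realType.
Local Notation C := R[i].

Lemma tensmx_suml (I : finType) m n p q (F : I -> 'M[C]_(m, n))
  (B : 'M[C]_(p, q)) : (\sum_i F i) *t B = \sum_i (F i *t B).
Proof.
apply/matrixP => i j; rewrite mxE !summxE mulr_suml.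
by apply: eq_bigr => k _; rewrite mxE.
Qed.

Lemma tensmxZl m n p q (c : C) (A : 'M[C]_(m, n)) (B : 'M[C]_(p, q)) :
  (c *: A) *t B = c *: (A *t B).
Proof. by apply/matrixP => i j; rewrite !mxE mulrA. Qed.

Lemma tensmxZr m n p q (c : C) (A : 'M[C]_(m, n)) (B : 'M[C]_(p, q)) :
  A *t (c *: B) = c *: (A *t B).
Proof. by apply/matrixP => i j; rewrite !mxE mulrCA. Qed.

Lemma tensmxBr m n p q (A : 'M[C]_(m, n)) (B B' : 'M[C]_(p, q)) :
  A *t (B - B') = A *t B - A *t B'.
Proof. by apply/matrixP => i j; rewrite !mxE mulrBr. Qed.

Lemma mxtrace_tens m n (A : 'M[C]_m) (B : 'M[C]_n) :
  \tr (A *t B) = \tr A * \tr B.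
Proof. by rewrite /mxtrace mulr_sum; apply: eq_bigr => i _; rewrite mxE. Qed.

(** The tensor product of two Gram matrices is the Gram matrix of the tensor product. *)
Lemma psdmx_tens m n (A : 'M[C]_m) (B : 'M[C]_n) :
  psdmx A -> psdmx B -> psdmx (A *t B).
Proof.
move=> /psdmx_gramP[S ->] /psdmx_gramP[T ->].
by rewrite -tensmx_mul -adjmx_tens; exact: psdmx_gram.
Qed.

Lemma density_mix (I : finType) n (pi : I -> R) (F : I -> 'M[C]_n) :
  Defs.pmf pi -> (forall i, density (F i)) ->
  density (\sum_i RtoC (pi i) *: F i).
Proof.
move=> [pi0 pi1] FD; split.
  by apply: psdmx_sum => i; apply: psdmxZ => //; case: (FD i).
rewrite linear_sum /= -(rmorph1 (@RtoC R)) -pi1 rmorph_sum.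
by apply: eq_bigr => i _; rewrite linearZ /= (proj2 (FD i)) mulr1.
Qed.

Variable X : finType.

Lemma density_ketbra (x : X) : density (ketbra R x).
Proof.
rewrite /ketbra; split; last first.
  rewrite /mxtrace (bigD1 (enum_rank x)) //= mxE !eqxx big1 ?addr0 // => i ix.
  by rewrite mxE (negbTE ix).
(* A projector is its own Gram matrix. *)
have -> : delta_mx (enum_rank x) (enum_rank x) =
    adjmx (delta_mx (enum_rank x) (enum_rank x))
    *m delta_mx (enum_rank x) (enum_rank x) :> 'M[C]_#|X|.
  by rewrite /adjmx trmx_delta map_delta_mx mul_delta_mx.
exact: psdmx_gram.
Qed.

Variables (d : nat) (p : X -> R).
Hypothesis pP : Defs.pmf p.

Lemma density_cq_state (rho : X -> 'M[C]_d) :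
  (forall x, density (rho x)) -> density (cq_state p rho).
Proof.
move=> rhoD; apply: density_mix => // x.
have [kP k1] := density_ketbra x; have [rP r1] := rhoD x.
by split; [exact: psdmx_tens|rewrite mxtrace_tens k1 r1 mulr1].
Qed.

Lemma density_cq_marginal : density (cq_marginal p).
Proof. by apply: density_mix => // x; exact: density_ketbra. Qed.

Lemma loewner_cq (rho : X -> 'M[C]_d) (sigma : 'M[C]_d) (mu : R) :
  (forall x, loewner (rho x) (RtoC mu *: sigma)) ->
  loewner (cq_state p rho) (RtoC mu *: (cq_marginal p *t sigma)).
Proof.
move=> le_rho; rewrite /loewner.
(* The difference is block diagonal, with blocks [p x] times [mu sigma - rho x]. *)
have -> : RtoC mu *: (cq_marginal p *t sigma) - cq_state p rho =
    \sum_x RtoC (p x) *: (ketbra R x *t (RtoC mu *: sigma - rho x)).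
  rewrite /cq_marginal tensmx_suml scaler_sumr -sumrB; apply: eq_bigr => x _.
  by rewrite tensmxZl tensmxBr tensmxZr scalerBr !scalerA mulrC.
apply: psdmx_sum => x; apply: psdmxZ; first by case: pP.
by apply: psdmx_tens; [case: (density_ketbra x)|exact: le_rho].
Qed.

Lemma Dmax_cq_le (rho : X -> 'M[C]_d) (sigma : 'M[C]_d) :
  (forall x, density (rho x)) -> psdmx sigma ->
  (Dmax (cq_state p rho) (cq_marginal p *t sigma) <=
   \big[maxe/-oo%E]_(x : X) Dmax (rho x) sigma)%E.
Proof.
move=> rhoD sigmaP; apply: lee_of_upper_bounds => r maxr.
apply/Dmax_leP; first by case: (density_cq_state rhoD).
  by apply: psdmx_tens => //; case: density_cq_marginal.
apply: loewner_cq => x; apply/Dmax_leP => //; first by case: (rhoD x).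
by apply: le_trans maxr; exact: le_bigmax.
Qed.

End ClassicalQuantum.

(** * The three inequalities of the chain *)

Section Chain.
Variables (R : realType) (X : finType) (d : nat).
Variables (p : X -> R) (rho : X -> 'M[R[i]]_d).
Hypotheses (pP : Defs.pmf p) (rhoD : forall x, density (rho x)).

Lemma Isand_le_Isand_infty (a : \bar R) : (0 < a)%E ->
  (Isand a (cq_marginal p) (cq_state p rho) <=
   Isand +oo (cq_marginal p) (cq_state p rho))%E.
Proof.
move=> a0; apply: le_ereal_inf_tmp => _ [sigma sigmaD <-].
have rhoXAD := density_cq_state pP rhoD.
apply: le_trans (Dsandwiched_le_Dmax a0 rhoXAD _); last first.
  apply: psdmx_tens; [by case: (density_cq_marginal pP)|by case: sigmaD].
by apply: ereal_inf_lbound; exists sigma.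
Qed.

(** Each mixture of the [rho x] is a density operator, hence a candidate [sigma] in the infimum
    defining [Isand]. *)
Lemma Isand_infty_le_Bquant :
  (Isand +oo (cq_marginal p) (cq_state p rho) <= Bquant rho)%E.
Proof.
apply: le_ereal_inf_tmp => _ [pi piP <-].
have mixD := density_mix piP rhoD.
apply: le_trans (Dmax_cq_le pP rhoD (proj1 mixD)).
by apply: ereal_inf_lbound; eexists; first exact: mixD.
Qed.

Lemma Bquant_le_Rquant (x0 : X) : (Bquant rho <= Rquant rho)%E.
Proof.
pose pi x : R := (x == x0)%:R.
have piP : Defs.pmf pi.
  split=> [x|]; first exact: ler0n.
  by rewrite (bigD1 x0) //= /pi eqxx big1 ?addr0 // => x /negbTE ->.
have piE : \sum_x RtoC (pi x) *: rho x = rho x0.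
  rewrite (bigD1 x0) //= /pi eqxx rmorph1 scale1r.
  rewrite big1 ?addr0 // => x /negbTE ->.
  by rewrite rmorph0 scale0r.
apply: (@le_trans _ _ (\big[maxe/-oo%E]_x Dmax (rho x) (rho x0))).
  by rewrite -piE; apply: ereal_inf_lbound; exists pi.
apply: le_bigmax2 => x _.
exact: (le_bigmax _ (fun x' => Dmax (rho x) (rho x'))).
Qed.

End Chain.

Theorem proposition4 (R : realType) (X : finType) (d : nat)
  (pX : X -> R) (rho : X -> 'M[R[i]]_d) :
  (forall x, 0 < pX x) ->
  \sum_(x : X) pX x = 1 ->
  (forall x, density (rho x)) ->
  forall a : \bar R, (0%:E < a)%E ->
    let I := fun b => Isand b (cq_marginal pX) (cq_state pX rho) in
    [/\ (I a <= I +oo%E)%E, (I +oo%E <= Bquant rho)%E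
      & (Bquant rho <= Rquant rho)%E].
Proof.
move=> p_gt0 p1 rhoD a a0 I.
have pP : Defs.pmf pX by split=> // x; exact: ltW.
split; [exact: Isand_le_Isand_infty|exact: Isand_infty_le_Bquant|].
(* The point mass needs an element of [X]; over an empty [X] the sum of [pX] would be 0. *)
have [x0 _|X0] := pickP (@predT X); first exact: Bquant_le_Rquant.
by move: p1; rewrite big_pred0 // => /esym/eqP; rewrite oner_eq0.
Qed.
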